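(* Let $G$ be a locally compact second countable (lcsc) group. If $G$ contains a strong approximate lattice, or if $G$ contains a finitely-generated uniform approximate lattice, then $G$ is unimodular.
   Context: Approximate subgroup: a subset $\Lambda$ of a group $G$ which is symmetric ($\Lambda=\Lambda^{-1}$), contains the identity, and for which there is a finite set $F\subset\Lambda^\infty$ with $\Lambda^2\subset F\Lambda$. Here $\Lambda^\infty$ is the subgroup of $G$ generated by $\Lambda$ and $\Lambda^2=\{xy: x,y\in\Lambda\}$. $\Lambda$ is called finitely generated if the abstract group $\Lambda^\infty$ is finitely generated. Let $d$ be any proper left-invariant metric on $G$ inducing its topology (the notions below do not depend on $d$). $\Lambda\subset G$ is uniformly discrete if there is $r>0$ with $d(x,y)\ge r$ for all distinct $x,y\in\Lambda$; relatively dense if there is $R>0$ such that every $g \in G$ satisfies $d(g,x)<R$ for some $x\in\Lambda$; a Delone set if it is non-empty and both uniformly discrete and relatively dense. A uniform approximate lattice in $G$ is an approximate subgroup which is a Delone set. Let $\mathcal C(G)$ be the compact space of closed subsets of $G$ with the Chabauty-Fell topology, generated by the sets $U_K=\{A: A\cap K=\emptyset\}$ ($K$ compact) and $U^V=\{A: A\cap V\ne\emptyset\}$ ($V$ open). $G$ acts on $\mathcal C(G)$ by $g.A=gA$. The (right-)hull of a closed $\Lambda\subset G$ is $X_\Lambda=\overline{G.\Lambda}\subset\mathcal C(G)$. A strong approximate lattice in $G$ is a uniformly discrete approximate subgroup $\Lambda\subset G$ such that there is a $G$-invariant Borel probability measure $\nu$ on $X_\Lambda$ with $\nu(\{\emptyset\})=0$.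 *)

(* Defs.v *)
From HB Require Import structures.
From mathcomp Require Import all_boot all_order all_algebra.
From mathcomp Require Import finmap.
From mathcomp Require Import all_classical all_reals all_analysis.

Set Implicit Arguments.
Unset Strict Implicit.
Unset Printing Implicit Defensive.

Import Order.TTheory GRing.Theory Num.Theory.

Local Open Scope classical_set_scope.
Local Open Scope ring_scope.

HB.mixin Record Group_isTopologicalGroup G & Topological G & Group G := {
  mulg_continuous : continuous (fun xy : G * G => (xy.1 * xy.2)%g);
  invg_continuous : continuous (fun x : G => x^-1%g)
}.

#[short(type="topologicalGroupType")]
HB.structure Definition TopologicalGroup :=
  {G of Topological G & Group G & Group_isTopologicalGroup G}.

Definition lcsc (G : topologicalType) : Prop :=
  [/\ hausdorff_space G, locally_compact [set: G] & @second_countable G].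

(* Measurable types are pointed in the library.  To put a Borel sigma-algebra
   on a space without a canonical point, one is supplied: it plays no other
   role. *)
Definition pointed_at (T : Type) (x : T) : Type := T.

HB.instance Definition _ (T : choiceType) (x : T) :=
  Choice.on (pointed_at x).
HB.instance Definition _ (T : choiceType) (x : T) :=
  isPointed.Build (pointed_at x) x.

Definition borel_sets (T : topologicalType) (x : T) :
  set (set (pointed_at x)) := @open T.
Arguments borel_sets {T} x.

Notation borel_at x := (g_sigma_algebraType (borel_sets x)).

Section Metric.
Context {R : realType} {G : topologicalGroupType}.
Implicit Types (d : G -> G -> R) (L : set G).

(* The last two fields say that d induces the topology of G and that it is
   proper. *)
Record proper_left_invariant_metric d : Prop := {
  plim_eq0 : forall x y, d x y = 0 <-> x = y;
  plim_sym : forall x y, d x y = d y x;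
  plim_triangle : forall x y z, d x z <= d x y + d y z;
  plim_left : forall g x y, d (g * x)%g (g * y)%g = d x y;
  plim_nbhs : forall x (A : set G),
    nbhs x A <-> exists2 r, 0 < r & [set y | d x y < r] `<=` A;
  plim_proper : forall x r, compact [set y | d x y <= r]
}.

Definition uniformly_discrete d L : Prop :=
  exists2 r, 0 < r & forall x y, L x -> L y -> x <> y -> r <= d x y.

Definition relatively_dense d L : Prop :=
  exists2 r, 0 < r & forall g, exists2 x, L x & d g x < r.

Definition delone d L : Prop :=
  [/\ L !=set0, uniformly_discrete d L & relatively_dense d L].

Lemma uniformly_discrete_closed d L : proper_left_invariant_metric d ->
  uniformly_discrete d L -> closed L.
Proof.
move=> md [r r0 Lr] x clx.
have [] := clx [set y | d x y < r / 2].
  by apply/(plim_nbhs md); exists (r / 2) => //; rewrite divr_gt0.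
move=> y [Ly /= xyr]; have [<-//|xy] := pselect (y = x).
have dxy : 0 < d x y.
  rewrite lt_neqAle; apply/andP; split.
    by apply/eqP => /esym/(plim_eq0 md)/esym.
  have : 0 <= d x y + d x y.
    rewrite {2}(plim_sym md).
    by apply: le_trans (plim_triangle md x y x); rewrite ((plim_eq0 md _ _).2 _).
  by rewrite -mulr2n pmulrn_lge0.
have [] := clx [set z | d x z < d x y].
  by apply/(plim_nbhs md); exists (d x y).
move=> z [Lz /= xz].
have zy : z <> y by move=> zy; move: xz; rewrite zy ltxx.
have := Lr _ _ Lz Ly zy; rewrite leNgt => /negP[].
apply: (le_lt_trans (plim_triangle md z x y)).
by rewrite (splitr r) ltrD// (plim_sym md) (lt_trans xz).
Qed.

End Metric.

Section ApproximateSubgroups.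
Context {G : groupType}.
Implicit Types H L S : set G.

Definition is_subgroup H : Prop :=
  [/\ H 1%g, (forall x y, H x -> H y -> H (x * y)%g)
    & forall x, H x -> H x^-1%g].

Definition generated_subgroup S : set G := smallest is_subgroup S.

Definition approximate_subgroup L : Prop :=
  [/\ L = [set x^-1%g | x in L], L 1%g &
      exists F : set G, [/\ finite_set F, F `<=` generated_subgroup L &
        [set (x * y)%g | x in L & y in L]
          `<=` [set (f * x)%g | f in F & x in L]]].

Definition approx_finitely_generated L : Prop :=
  exists2 S : set G, finite_set S &
    generated_subgroup S = generated_subgroup L.

End ApproximateSubgroups.

Definition uniform_approximate_lattice {R : realType}
    {G : topologicalGroupType} (d : G -> G -> R) (L : set G) : Prop :=
  approximate_subgroup L /\ delone d L.

Record closed_sets (G : topologicalType) : Type := ClosedSet {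
  closed_carrier :> set G;
  closed_setsP : closed closed_carrier
}.

HB.instance Definition _ (G : topologicalType) := gen_eqMixin (closed_sets G).
HB.instance Definition _ (G : topologicalType) :=
  gen_choiceMixin (closed_sets G).

Lemma closed_sets_inj (G : topologicalType) :
  injective (@closed_carrier G).
Proof.
move=> [A cA] [B cB] /= AB; subst B; congr ClosedSet; exact: Prop_irrelevance.
Qed.

Section ChabautyFell.
Context {G : topologicalType}.

Definition fell_miss (K : set G) : set (closed_sets G) :=
  [set A : closed_sets G | A `&` K = set0].
Definition fell_hit (V : set G) : set (closed_sets G) :=
  [set A : closed_sets G | A `&` V !=set0].

Definition fell_subbase : set (set (closed_sets G)) :=
  [set fell_miss K | K in compact] `|` [set fell_hit V | V in open].

HB.instance Definition _ :=
  isSubBaseTopological.Build (closed_sets G) fell_subbase id.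

Lemma fell_subbase_nbhs (A : closed_sets G) B :
  fell_subbase B -> B A -> nbhs A B.
Proof.
move=> sB BA; exists B; split => //; exists [set B].
  move=> _ ->; exists [fset B]%fset; first by move=> C /fset1P ->; rewrite inE.
  rewrite eqEsubset; split=> [x Bx|x Bx C /fset1P -> //].
  by apply: Bx; exact/fset1P.
by rewrite bigcup_set1.
Qed.

Lemma fell_continuous (f : closed_sets G -> closed_sets G) :
  (forall B, fell_subbase B -> fell_subbase (f @^-1` B)) -> continuous f.
Proof.
move=> fB A U [V [[D' sD' <-]] [E D'E EA] sU].
have [F FD EF] := sD' _ D'E.
change (nbhs A (f @^-1` U)).
apply: (@filterS _ _ _ (f @^-1` E)).
  by move=> x Ex; apply: sU; exists E.
rewrite -EF; apply: (@filterS _ _ _ (\bigcap_(i in [set` F]) (f @^-1` i))).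
  by move=> x Fx i Fi; exact: Fx.
apply: filter_bigI => B BF.
have sB : fell_subbase B by apply/set_mem/FD.
by apply: fell_subbase_nbhs; [exact: fB|move: EA; rewrite -EF; exact].
Qed.

End ChabautyFell.

Section Hull.
Context {G : topologicalGroupType}.
Implicit Types (g : G) (A L : closed_sets G).

Definition ltranslate g (A : set G) : set G := [set (g * x)%g | x in A].
Definition rtranslate g (A : set G) : set G := [set (x * g)%g | x in A].

Lemma ltranslateE g (A : set G) : ltranslate g A = [set x | A (g^-1 * x)%g].
Proof.
rewrite eqEsubset; split=> [_ [x Ax <-]/=|x /= Ax]; first by rewrite mulKg.
by exists (g^-1 * x)%g => //; rewrite mulVKg.
Qed.

Lemma lmulg_continuous g : continuous (fun x : G => (g * x)%g).
Proof.
move=> x; apply: (@continuous_comp _ _ _ (fun x : G => (g, x))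
  (fun xy : G * G => (xy.1 * xy.2)%g)); last exact: mulg_continuous.
by apply: cvg_pair; [exact: cvg_cst|exact: cvg_id].
Qed.

Lemma ltranslate_closed g (A : set G) : closed A -> closed (ltranslate g A).
Proof.
move=> cA; rewrite ltranslateE.
by apply: (preimage_closed _ cA) => x _; exact: lmulg_continuous.
Qed.

Definition act g A : closed_sets G :=
  ClosedSet (ltranslate_closed (g := g) (@closed_setsP _ A)).

Lemma act1 A : act 1%g A = A.
Proof.
by apply: closed_sets_inj; rewrite /= ltranslateE; apply/funext => x /=;
  rewrite invg1 mul1g.
Qed.

Lemma actM g h A : act (g * h)%g A = act g (act h A).
Proof.
apply: closed_sets_inj; rewrite /= !ltranslateE; apply/funext => x /=.
by rewrite invgM mulgA.
Qed.

Lemma act_continuous g : continuous (act g).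
Proof.
apply: fell_continuous => B [[K cK <-]|[V oV <-]]; [left|right].
- exists (ltranslate g^-1%g K).
    apply: continuous_compact cK.
    by apply: continuous_subspaceT => x; exact: lmulg_continuous.
  apply/funext => A; apply/propext; rewrite /fell_miss /= !ltranslateE invgK.
  split=> /seteqP[h _]; apply/seteqP; split=> // x /= [Ax Kx].
    by apply: (h (g^-1 * x)%g); rewrite /= mulVKg.
  by apply: (h (g * x)%g); rewrite /= mulKg.
- exists (ltranslate g^-1%g V).
    rewrite ltranslateE invgK.
    by apply: open_comp oV => x _; exact: lmulg_continuous.
  apply/funext => A; apply/propext; rewrite /fell_hit /= !ltranslateE invgK.
  split=> -[x /= [Ax Vx]]; first by exists (g * x)%g; rewrite /= mulKg.
  by exists (g^-1 * x)%g; rewrite /= mulVKg.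
Qed.

Definition hull L : set (closed_sets G) := closure [set act g L | g in [set: G]].

Lemma hull_base L : hull L L.
Proof. by apply: subset_closure; exists 1%g => //; exact: act1. Qed.

Lemma hull_act L g A : hull L A -> hull L (act g A).
Proof.
move=> hA U /(act_continuous (g := g)) /hA [_ [[h _ <-] Uh]].
by exists (act (g * h)%g L); rewrite actM; split => //; exists (g * h)%g;
  rewrite ?actM.
Qed.

Definition hull_point L : set_type (hull L) :=
  exist _ L (mem_set (@hull_base L)).

Definition act_hull L g (A : set_type (hull L)) : set_type (hull L) :=
  exist _ (act g (\val A)) (mem_set (@hull_act L g _ (set_valP A))).

Definition translate_hull L g (B : set (set_type (hull L))) :
  set (set_type (hull L)) := [set act_hull g A | A in B].

(* {set0}, as a subset of the hull; it is empty if set0 is not in the hull. *)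
Definition hull_empty L : set (set_type (hull L)) :=
  [set A | closed_carrier (\val A) = set0].

End Hull.
Arguments hull_empty {G} L.

Notation borel_hull L := (borel_at (hull_point L)).

(* A uniformly discrete set is closed (uniformly_discrete_closed), so cL is
   not an extra hypothesis: it is there because hulls are defined for closed
   sets. *)
Definition strong_approximate_lattice {R : realType}
    {G : topologicalGroupType} (d : G -> G -> R) (L : set G) : Prop :=
  [/\ approximate_subgroup L, uniformly_discrete d L &
      exists (cL : closed L)
             (nu : probability (borel_hull (ClosedSet cL)) R),
        (forall (g : G) (B : set (borel_hull (ClosedSet cL))),
           measurable B -> nu (translate_hull g B) = nu B) /\
        nu (hull_empty (ClosedSet cL)) = 0%E].

Notation borel_group G := (borel_at (1%g : G)).

Section Unimodular.
Context {R : realType} {G : topologicalGroupType}.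

(* G is meant to be lcsc: there a Borel measure that is finite on compact sets
   is automatically regular. *)
Definition left_haar_measure
    (mu : {measure set borel_group G -> \bar R}) : Prop :=
  [/\ mu setT <> 0%E,
      (forall K : set G, compact K -> (mu K < +oo)%E) &
      forall (g : G) (B : set (borel_group G)),
        measurable B -> mu (ltranslate g B) = mu B].

(* The quantifier ranges over all left Haar measures because the library does
   not provide one; they are the positive multiples of one another. *)
Definition unimodular : Prop :=
  forall mu : {measure set borel_group G -> \bar R},
    left_haar_measure mu ->
    forall (g : G) (B : set (borel_group G)),
      measurable B -> mu (rtranslate g B) = mu B.

End Unimodular.
Arguments unimodular R G : clear implicits.

(* Main.v *)
From HB Require Import structures.
Require Import Defs.
From mathcomp Require Import all_boot all_order all_algebra.
From mathcomp Require Import all_classical all_reals all_analysis.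
From mathcomp Require Import measurable_realfun lra.

(* Write B_r for the ball of radius r around 1, m for a left Haar measure and D
   for the modular function.  Suppose that S is a subset of G such that the
   sets U x, for x in S and some ball U, are pairwise disjoint, and such that,
   for some b and for any finite family of balls h B_b, some translate p S,
   with p in B_b, meets at least half of them.  Take for the h a maximal
   2b-separated subset of A = B_1 g B_1.  There are at least m(A) / m(B_2b) of
   them, and they yield half as many points x of S lying within bounded
   distance of A on both sides; the sets U x are disjoint, of measure
   D(x) m(U) >= c D(g) m(U), and contained in B_r g B_r, whose measure is at most
   C m(A), with r, c and C independent of g.  Hence D is bounded, and D = 1.

   A uniform approximate lattice S = L has this property with p = 1, as it is
   symmetric.  If L is a strong approximate lattice, then S = L^2 has it too:
   choose b such that a random element P of the hull meets B_b, hence by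
   invariance any given h B_b, with probability at least 3/4.  In the mean, P
   meets both B_b and h B_b for at least half of the h, so some P does, and P is
   contained in p L^2 for any p in P.

   That D exists, i.e. that the Haar measure is unique up to a factor, follows
   as for uniformly distributed measures on metric spaces (Christensen), by
   applying Tonelli to sets of pairs of points at distance less than r. *)

Set Implicit Arguments.
Unset Strict Implicit.
Unset Printing Implicit Defensive.

Import Order.TTheory GRing.Theory Num.Theory.

Local Open Scope classical_set_scope.
Local Open Scope ring_scope.

(** * Metric balls and left Haar measures *)

Section LeftInvariantMetric.
Context {R : realType} {G : topologicalGroupType} (d : G -> G -> R).
Hypothesis md : proper_left_invariant_metric d.
Implicit Types (x y z g : G) (r s : R) (A B U : set G).

Lemma metricxx x : d x x = 0. Proof. exact/(plim_eq0 md). Qed.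

Lemma metric_ge0 x y : 0 <= d x y.
Proof.
have := plim_triangle md x y x; rewrite metricxx (plim_sym md y x).
by rewrite -mulr2n pmulrn_lge0.
Qed.

Lemma metricE x y : d x y = d 1%g (x^-1 * y)%g.
Proof. by rewrite -(plim_left md x^-1%g) mulVg. Qed.

Lemma normgV x : d 1%g x^-1%g = d 1%g x.
Proof. by rewrite -(plim_left md x) mulg1 mulgV (plim_sym md). Qed.

Lemma normgM x y : d 1%g (x * y)%g <= d 1%g x + d 1%g y.
Proof.
apply: le_trans (plim_triangle md _ x _) _.
by rewrite lerD2l (metricE x) mulKg.
Qed.

Definition gball r : set G := [set x | d 1%g x < r].

Lemma gball1 r : 0 < r -> gball r 1%g.
Proof. by rewrite /gball /= metricxx. Qed.

Lemma gballV r x : gball r x -> gball r x^-1%g.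
Proof. by rewrite /gball /= normgV. Qed.

Lemma gballM r s x y : gball r x -> gball s y -> gball (r + s) (x * y)%g.
Proof. by move=> ? ?; apply: le_lt_trans (normgM _ _) _; exact: ltrD. Qed.

Lemma gballW r s : r <= s -> gball r `<=` gball s.
Proof. by move=> rs x /= xr; exact: lt_le_trans rs. Qed.

Lemma ltranslate_gball g r : ltranslate g (gball r) = [set y | d g y < r].
Proof. by rewrite ltranslateE; apply/funext => x; rewrite /gball /= -metricE. Qed.

Lemma metric_open (A : set G) :
  (forall x, A x -> exists2 r, 0 < r & [set y | d x y < r] `<=` A) -> open A.
Proof. by move=> h; rewrite openE => x Ax; apply/(plim_nbhs md)/h. Qed.

Lemma open_metric (A : set G) x : open A -> A x ->
  exists2 r, 0 < r & [set y | d x y < r] `<=` A.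
Proof. by move=> oA Ax; apply/(plim_nbhs md); exact: open_nbhs_nbhs. Qed.

Lemma metric_ball_open x r : open [set y | d x y < r].
Proof.
apply: metric_open => y /= xyr; exists (r - d x y); first by rewrite subr_gt0.
move=> z /=; rewrite ltrBrDl => h; exact: le_lt_trans (plim_triangle md x y z) h.
Qed.

Lemma gball_open r : open (gball r). Proof. exact: metric_ball_open. Qed.

Lemma ltranslate_open g U : open U -> open (ltranslate g U).
Proof.
move=> oU; apply: metric_open => _ [x Ux <-].
have [r r0 rU] := open_metric oU Ux; exists r => // y /=.
rewrite -(plim_left md g^-1%g) mulKg => h.
by exists (g^-1 * y)%g; [exact: rU|rewrite mulVKg].
Qed.

Lemma rmulg_continuous g : continuous (fun x : G => (x * g)%g).
Proof.
move=> x; apply: (@continuous_comp _ _ _ (fun x : G => (x, g))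
  (fun xy : G * G => (xy.1 * xy.2)%g)); last exact: mulg_continuous.
by apply: cvg_pair; [exact: cvg_id|exact: cvg_cst].
Qed.

Lemma rtranslateE g A : rtranslate g A = (fun x => x * g^-1)%g @^-1` A.
Proof.
rewrite eqEsubset; split=> [_ [x Ax <-]/=|x /= Ax]; first by rewrite mulgK.
by exists (x * g^-1)%g => //; rewrite mulgVK.
Qed.

Lemma rtranslate_open g U : open U -> open (rtranslate g U).
Proof.
rewrite rtranslateE => oU; apply: open_comp => // x _; exact: rmulg_continuous.
Qed.

Definition set_mulg A B : set G := [set (x * y)%g | x in A & y in B].

Lemma set_mulg_open A U : open U -> open (set_mulg A U).
Proof.
move=> oU; apply: metric_open => _ [a Aa [x Ux <-]].
have [|r r0 rU] := open_metric (ltranslate_open a oU) (x := (a * x)%g).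
  by exists x.
by exists r => // y /rU [u Uu <-]; exists a => //; exists u.
Qed.

(** The test sets of the proof: they have finite Haar measure, are stable under translations on both
    sides, and form a pi-system generating the Borel sets. *)
Definition bounded_open U := open U /\ exists r, U `<=` gball r.

Lemma gball_bounded_open r : bounded_open (gball r).
Proof. by split; [exact: gball_open|exists r]. Qed.

Lemma ltranslate_bounded_open g U :
  bounded_open U -> bounded_open (ltranslate g U).
Proof.
move=> [oU [r Ur]]; split; first exact: ltranslate_open.
exists (d 1%g g + 1 + r) => _ [x /Ur xr <-].
by apply: gballM => //; rewrite /gball /= ltrDl.
Qed.

Lemma rtranslate_bounded_open g U :
  bounded_open U -> bounded_open (rtranslate g U).
Proof.
move=> [oU [r Ur]]; split; first exact: rtranslate_open.
exists (r + (d 1%g g + 1)) => _ [x /Ur xr <-].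
by apply: gballM => //; rewrite /gball /= ltrDl.
Qed.

Lemma set_mulg_bounded_open A U : (exists r, A `<=` gball r) ->
  bounded_open U -> bounded_open (set_mulg A U).
Proof.
move=> [s As] [oU [r Ur]]; split; first exact: set_mulg_open.
by exists (s + r) => _ [a /As ? [x /Ur ? <-]]; exact: gballM.
Qed.

End LeftInvariantMetric.

Section SigmaFinitePackage.
Context {disp : measure_display} {T : measurableType disp} {R : realType}.
Variable mu : {measure set T -> \bar R}.
Hypothesis sfmu : sigma_finite setT mu.

(* The unused argument lets the sigma-finite structure be inferred. *)
Definition sigma_finite_package := (fun=> mu : set T -> \bar R) sfmu.
HB.instance Definition _ := Measure.on sigma_finite_package.
HB.instance Definition _ :=
  Measure_isSigmaFinite.Build _ _ _ sigma_finite_package sfmu.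

End SigmaFinitePackage.

(** * Haar measure of balls, and a comparison of two Haar measures *)

Section LeftHaar.
Context {R : realType} {G : topologicalGroupType} (d : G -> G -> R).
Hypothesis lcscG : lcsc G.
Hypothesis md : proper_left_invariant_metric d.
Implicit Types (x y z g : G) (r s : R) (A B U : set G).

Lemma open_borel (U : set G) : open U -> measurable (U : set (borel_group G)).
Proof. exact: sub_sigma_algebra. Qed.

Lemma gball_borel r : measurable (gball d r : set (borel_group G)).
Proof. by apply: open_borel; exact: gball_open. Qed.

(** One point is chosen in each non-empty member of a countable base. *)
Lemma dense_sequence : exists q : nat -> G,
  forall x r, 0 < r -> exists n, d x (q n) < r.
Proof.
have [_ _ [B /countable_injP[f injf] [oB nB]]] := lcscG.
pose b n : set G := xget set0 [set U | B U /\ f U = n].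
exists (fun n => xget 1%g (b n)) => x r r0.
have [|U [BU Ux] Ur] := nB x [set y | d x y < r].
  by apply/(plim_nbhs md); exists r.
exists (f U).
have -> : b (f U) = U.
  have [BbU fbU] : B (b (f U)) /\ f (b (f U)) = f U.
    exact: (xgetI (P := [set V | B V /\ f V = f U]) set0 (x := U)).
  by apply: injf => //; rewrite inE.
by apply: Ur; exact: (xgetI (P := U) 1%g (x := x)).
Qed.

(** The sigma-algebra here is the product of the Borel ones, so the set, although open, has to be
    written as a countable union of products of balls centred on a dense sequence. *)
Lemma metric_lt_measurable r : measurable
  [set xy : borel_group G * borel_group G | d xy.1 xy.2 < r].
Proof.
have [q qP] := dense_sequence.
have near_q (x y : G) : d x y < r -> exists n k,
    d (q n) x < k.+1%:R^-1 /\ d (q n) y < r - k.+1%:R^-1.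
  move=> xyr; have e0 : 0 < (r - d x y) / 2 by rewrite divr_gt0// subr_gt0.
  (* Once [1/(k+1)] is below half the gap [r - d x y], any [q n] within that distance of [x] will
     do. *)
  have [k _ /(_ _ (leqnn _)) /= ke] := near_infty_natSinv_lt (PosNum e0).
  suff [n xn] : exists n, d (q n) x < k.+1%:R^-1 /\ d (q n) y < r - k.+1%:R^-1.
    by exists n, k.
  have : 0 < k.+1%:R^-1 :> R by rewrite invr_gt0.
  move: (k.+1%:R^-1 : R) ke => e ke /(qP x)[n xn]; exists n.
  have := plim_triangle md (q n) x y; rewrite (plim_sym md _ x); lra.
have -> : [set xy : borel_group G * borel_group G | d xy.1 xy.2 < r] =
    \bigcup_n \bigcup_k ([set x | d (q n) x < k.+1%:R^-1] `*`
                         [set y | d (q n) y < r - k.+1%:R^-1]).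
  rewrite eqEsubset; split=> [[x y] /near_q[n [k]]|[x y] [n _] [k _] []].
    by exists n => //; exists k.
  move=> /= xk yk; apply: le_lt_trans (plim_triangle md x (q n) y) _.
  rewrite (plim_sym md x).
  by have := ltrD xk yk; rewrite addrCA subrr addr0.
apply: bigcupT_measurable => n; apply: bigcupT_measurable => k.
by apply: measurableX; exact: open_borel (metric_ball_open md _ _).
Qed.

Section Haar.
Variable mu : {measure set borel_group G -> \bar R}.
Hypothesis hmu : left_haar_measure mu.

Lemma haar_gball_lty r : (mu (gball d r) < +oo)%E.
Proof.
have [_ fmu _] := hmu.
have cK : compact [set y | d 1%g y <= r] by exact: plim_proper.
apply: le_lt_trans (fmu _ cK).
apply: le_measure; rewrite ?inE; first exact: gball_borel.
- rewrite -(setCK [set y | _]); apply: measurableC; apply: open_borel.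
  apply: closed_openC; apply: compact_closed cK; by have [] := lcscG.
- by move=> x /ltW.
Qed.

Lemma haar_ltranslate_gball g r : mu [set y | d g y < r] = mu (gball d r).
Proof.
have [_ _ lmu] := hmu; rewrite -(ltranslate_gball md); apply: lmu.
exact: gball_borel.
Qed.

(** Countably many translates of the ball cover [G], so a null ball would force [mu] to vanish. *)
Lemma haar_gball_gt0 r : 0 < r -> (0 < mu (gball d r))%E.
Proof.
move=> r0; rewrite lt0e measure_ge0 andbT; apply/eqP => mu0.
have [muT _ _] := hmu; apply: muT.
have [q qP] := dense_sequence.
have : mu.-negligible (\bigcup_n ([set y | d (q n) y < r] : set (borel_group G))).
  apply: negligible_bigcup => n; exists [set y | d (q n) y < r]; split => //.
    by apply: open_borel; exact: metric_ball_open.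
  by rewrite haar_ltranslate_gball.
rewrite (_ : \bigcup_n _ = setT); first by move/measure_negligible; apply.
rewrite eqEsubset; split=> // x _; have [n xn] := qP x r r0.
by exists n => //=; rewrite (plim_sym md).
Qed.

Lemma haar_gball_fin_num r : mu (gball d r) \is a fin_num.
Proof. by rewrite ge0_fin_numE// haar_gball_lty. Qed.

Lemma haar_sigma_finite : sigma_finite setT mu.
Proof.
exists (fun n => gball d n%:R); last first.
  by move=> n; split; [exact: gball_borel|exact: haar_gball_lty].
rewrite eqEsubset; split=> // x _; exists (Num.truncn (d 1%g x)).+1 => //.
by rewrite /gball /= truncnS_gt.
Qed.

End Haar.

Definition inner_points r U : set G := [set x | [set y | d x y < r] `<=` U].

(** The complement is the union of the open balls of radius [r] centred outside [U]. *)
Lemma inner_points_measurable r U :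
  measurable (inner_points r U : set (borel_group G)).
Proof.
rewrite (_ : inner_points r U = ~` \bigcup_(y in ~` U) [set x | d y x < r]).
  apply: measurableC; apply: open_borel; apply: bigcup_open => y _.
  exact: metric_ball_open.
rewrite eqEsubset; split=> x /= h.
  by move=> [y Uy /=]; rewrite (plim_sym md) => /h.
by move=> y xy; apply: contrapT => Uy; apply: h; exists y => //=;
  rewrite (plim_sym md).
Qed.

(* Tonelli for the set of pairs [(x, y)] with [B(x, r) `<=` U] and [d x y < r]:
   its sections over [x] are balls, and those over [y] are contained in balls
   and empty unless [U y]. *)
Lemma haar_inner_points_le (mu nu : {measure set borel_group G -> \bar R}) r U :
  left_haar_measure mu -> left_haar_measure nu -> 0 < r -> open U ->
  (mu (inner_points r U) * nu (gball d r) <= mu (gball d r) * nu U)%E.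
Proof.
move=> hmu hnu r0 oU.
pose m1 : {sigma_finite_measure set borel_group G -> \bar R} :=
  sigma_finite_package (haar_sigma_finite hmu).
pose m2 : {sigma_finite_measure set borel_group G -> \bar R} :=
  sigma_finite_package (haar_sigma_finite hnu).
pose V := inner_points r U.
have mV : measurable (V : set (borel_group G)) := inner_points_measurable r U.
pose D : set (borel_group G * borel_group G) :=
  (V `*` setT) `&` [set xy | d xy.1 xy.2 < r].
have mD : measurable D.
  by apply: measurableI (metric_lt_measurable r); exact: measurableX.
have := indic_fubini_tonelli m1 m2 mD.
rewrite indic_fubini_tonelli_FE // indic_fubini_tonelli_GE//.
have -> : (\int[m1]_x (m2 \o xsection D) x =
           \int[m1]_(x in V) (cst (nu (gball d r)) x))%E.
  rewrite [RHS]integral_mkcond; apply: eq_integral => x _ /=.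
  rewrite patchE; case: ifPn => [/set_mem Vx|/negP Vx].
    rewrite -(haar_ltranslate_gball hnu x r); congr (nu _).
    rewrite /xsection /D; apply/funext => y; apply/propext => /=.
    by rewrite inE /=; split=> [[_ ]|].
  rewrite (_ : xsection D x = set0); first exact: (measure0 nu).
  rewrite -subset0 => y; rewrite /xsection /D /= inE => -[[Vx' _] _].
  by apply: Vx; rewrite inE.
rewrite integral_cst// muleC => ->.
rewrite -integral_cst//; last exact: open_borel.
rewrite [leRHS]integral_mkcond; apply: ge0_le_integral => //=.
- exact: measurable_fun_ysection.
- have mcst : measurable_fun (U : set (borel_group G)) (cst (mu (gball d r))).
    exact: measurable_cst.
  exact: (iffLR (measurable_restrictT _ (open_borel oU)) mcst).
- move=> y _; rewrite patchE; case: ifPn => [/set_mem Uy|/negP Uy].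
    rewrite -(haar_ltranslate_gball hmu y r).
    apply: le_measure; rewrite ?inE.
    + exact: measurable_ysection.
    + exact: open_borel (metric_ball_open md _ _).
    + move=> x; rewrite /ysection /D /= inE => -[_ /=].
      by rewrite (plim_sym md).
  rewrite (_ : ysection D y = set0); first by rewrite (measure0 mu).
  rewrite -subset0 => x; rewrite /ysection /D /= inE => -[[Vx _] /=].
  by move=> /Vx Uy'; apply: Uy; rewrite inE.
Qed.

End LeftHaar.

(** * Uniqueness of the Haar measure *)

Section HaarUniqueness.
Context {R : realType} {G : topologicalGroupType} (d : G -> G -> R).
Hypothesis lcscG : lcsc G.
Hypothesis md : proper_left_invariant_metric d.
Implicit Types (x y z g : G) (r s : R) (A B U : set G).
Implicit Types mu nu : {measure set borel_group G -> \bar R}.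

Lemma haar_fin_num mu U : left_haar_measure mu -> bounded_open d U ->
  mu U \is a fin_num.
Proof.
move=> hmu [oU [r Ur]]; rewrite ge0_fin_numE//.
apply: le_lt_trans (haar_gball_lty lcscG md hmu r).
by apply: le_measure; rewrite ?inE//; [exact: open_borel|exact: gball_borel].
Qed.

(** An open set is the increasing union of its sets of inner points as the radius decreases to 0. *)
Lemma haar_inner_points_cvg mu U : open U ->
  mu (inner_points d n.+1%:R^-1 U) @[n --> \oo] --> mu U.
Proof.
move=> oU.
have UE : \bigcup_n inner_points d n.+1%:R^-1 U = U.
  rewrite eqEsubset; split=> [x [n _] /(_ x)|x Ux].
    by apply; rewrite /= (metricxx md) invr_gt0.
  have [e e0 eU] := open_metric md oU Ux.
  have [n _ /(_ _ (leqnn _)) /= ne] := near_infty_natSinv_lt (PosNum e0).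
  by exists n => // y /= xy; apply: eU; exact: lt_trans ne.
rewrite -[in X in _ --> X]UE; apply: nondecreasing_cvg_mu.
- by move=> n; exact: inner_points_measurable.
- by apply: bigcupT_measurable => n; exact: inner_points_measurable.
- move=> n k nk; apply/subsetPset => x xU y /= xy; apply: xU => /=.
  by apply: lt_le_trans xy _; rewrite lef_pV2 ?posrE// ler_nat ltnS.
Qed.

(** Multiply [haar_inner_points_le] for [U] by the same inequality for [W] with the measures
    exchanged: the measures of balls cancel, and the radius can tend to 0. *)
Let haar_ratio_le mu nu U W :
  left_haar_measure mu -> left_haar_measure nu ->
  bounded_open d U -> bounded_open d W -> (mu U * nu W <= nu U * mu W)%E.
Proof.
move=> hmu hnu bU bW; have [[oU _] [oW _]] := (bU, bW).
pose I k A := inner_points d k.+1%:R^-1 A.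
have Imono k l A : (k <= l)%N -> I k A `<=` I l A.
  move=> kl x xA y /= xy; apply: xA => /=.
  by apply: lt_le_trans xy _; rewrite lef_pV2 ?posrE// ler_nat ltnS.
have fin (m : {measure set borel_group G -> \bar R}) (A : set G) k :
    left_haar_measure m -> bounded_open d A ->
    m (I k A) \is a fin_num.
  move=> hm bA; have [oA _] := bA; rewrite ge0_fin_numE//.
  apply: (@le_lt_trans _ _ (m A)); last first.
    by rewrite -ge0_fin_numE//; exact: haar_fin_num.
  apply: le_measure; rewrite ?inE.
  - exact: inner_points_measurable.
  - exact: open_borel.
  - by move=> x; apply; rewrite /= (metricxx md) invr_gt0.
(* Independent indices [k] and [l] allow the two limits to be taken one at a time. *)
have bound k l : (mu (I k U) * nu (I l W) <= nu U * mu W)%E.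
  pose n := maxn k l; pose r : R := n.+1%:R^-1.
  have r0 : 0 < r by rewrite invr_gt0.
  have muU := haar_inner_points_le lcscG md hmu hnu r0 oU.
  have nuW := haar_inner_points_le lcscG md hnu hmu r0 oW.
  apply: (@le_trans _ _ (mu (I n U) * nu (I n W)))%E.
    apply: lee_pmul => //; apply: le_measure; rewrite ?inE;
      try exact: inner_points_measurable; apply: Imono; rewrite /n.
    - exact: leq_maxl.
    - exact: leq_maxr.
  have := haar_gball_gt0 lcscG md hmu r0; have := haar_gball_gt0 lcscG md hnu r0.
  move: muU nuW; rewrite -/(I n U) -/(I n W).
  rewrite -(fineK (haar_gball_fin_num lcscG md hmu r)).
  rewrite -(fineK (haar_gball_fin_num lcscG md hnu r)).
  rewrite -(fineK (fin _ _ n hmu bU)) -(fineK (fin _ _ n hnu bW)).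
  rewrite -(fineK (haar_fin_num hnu bU)) -(fineK (haar_fin_num hmu bW)).
  have u0 : 0 <= fine (mu (I n U)) by exact: fine_ge0.
  have w0 : 0 <= fine (nu (I n W)) by exact: fine_ge0.
  rewrite -!EFinM !lee_fin !lte_fin => h1 h2 b0 a0.
  rewrite -(ler_pM2r (mulr_gt0 a0 b0)).
  have := ler_pM (mulr_ge0 u0 (ltW b0)) (mulr_ge0 w0 (ltW a0)) h1 h2.
  lra.
have bound2 l : (mu U * nu (I l W) <= nu U * mu W)%E.
  apply: (@cvge_to_le _ \oo _ _ (fun k => mu (I k U) * nu (I l W)))%E.
    by apply: cvgeZr; [exact: fin|exact: haar_inner_points_cvg].
  by near=> k; exact: bound.
apply: (@cvge_to_le _ \oo _ _ (fun l => mu U * nu (I l W)))%E.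
  by apply: cvgeZl; [exact: haar_fin_num|exact: haar_inner_points_cvg].
by near=> l; exact: bound2.
Unshelve. all: by end_near. Qed.

Lemma haar_ratio mu nu U W :
  left_haar_measure mu -> left_haar_measure nu ->
  bounded_open d U -> bounded_open d W -> (mu U * nu W = nu U * mu W)%E.
Proof.
move=> hmu hnu bU bW; apply/eqP; rewrite eq_le haar_ratio_le//=.
exact: haar_ratio_le.
Qed.

(** Left and right translations commute, so the pushforward of [mu] under a right translation is
    still left-invariant. *)
Lemma haar_rtranslate mu g : left_haar_measure mu ->
  exists2 nu, left_haar_measure nu & forall A, nu A = mu (rtranslate g A).
Proof.
move=> hmu; pose f (x : borel_group G) : borel_group G := (x * g^-1)%g.
have mf : measurable_fun setT f.
  apply: (@measurability _ _ (borel_group G) (borel_group G) setT f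
    (@borel_sets G 1%g)) => // _ [U oU <-].
  rewrite setTI; apply: open_borel; apply: open_comp oU => x _.
  exact: rmulg_continuous.
have nuE A : pushforward mu f A = mu (rtranslate g A).
  by rewrite rtranslateE.
exists (measure_function_pushforward__canonical__measure_function_Measure
  mu mf) => //=.
have [mu0 muK muL] := hmu; split.
- by move=> h; apply: mu0; rewrite -[RHS]h.
- move=> K cK; rewrite [ltLHS]nuE; apply: muK.
  apply: continuous_compact cK.
  by apply: continuous_subspaceT => x; exact: rmulg_continuous.
- move=> h B mB; rewrite [LHS]nuE [RHS]nuE -[RHS](muL h); last first.
    by rewrite rtranslateE -[X in measurable X]setTI; exact: mf.
  congr (mu _); rewrite !rtranslateE !ltranslateE.
  by apply/funext => x /=; rewrite mulgA.
Qed.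

End HaarUniqueness.

(** * The modular function *)

Section Modular.
Context {R : realType} {G : topologicalGroupType} (d : G -> G -> R).
Hypothesis lcscG : lcsc G.
Hypothesis md : proper_left_invariant_metric d.
Variable mu : {measure set borel_group G -> \bar R}.
Hypothesis hmu : left_haar_measure mu.
Implicit Types (x y z g : G) (r s : R) (A B U : set G).

(** As [fine] sends infinity to 0, this is the measure only where the latter is finite, in
    particular on bounded open sets. *)
Definition content U : R := fine (mu U).

Lemma contentE U : bounded_open d U -> mu U = (content U)%:E.
Proof. by move=> bU; rewrite fineK//; exact: (haar_fin_num lcscG md hmu). Qed.

Lemma content_ge0 U : 0 <= content U. Proof. exact: fine_ge0. Qed.

Lemma content_gball_gt0 r : 0 < r -> 0 < content (gball d r).
Proof.
move=> r0; rewrite -lte_fin -contentE; first exact: (haar_gball_gt0 lcscG md hmu).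
exact: gball_bounded_open.
Qed.

Lemma content_ltranslate g U : bounded_open d U ->
  content (ltranslate g U) = content U.
Proof.
by move=> [oU _]; have [_ _ L] := hmu; rewrite /content L//; exact: open_borel.
Qed.

Lemma le_content U A : bounded_open d U -> bounded_open d A -> U `<=` A ->
  content U <= content A.
Proof.
move=> bU bA UA; rewrite -lee_fin -!contentE//.
by apply: le_measure; rewrite ?inE//; apply: open_borel; [case: bU|case: bA].
Qed.

Lemma content_cover (s : seq G) (F : G -> set G) A :
  bounded_open d A -> (forall x, bounded_open d (F x)) ->
  (forall y, A y -> exists2 x, x \in s & F x y) ->
  content A <= \sum_(x <- s) content (F x).
Proof.
move=> bA bF AF; rewrite -lee_fin -contentE// -sumEFin.
under eq_bigr do rewrite -contentE//.
have mF x : measurable (F x : set (borel_group G)).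
  by apply: open_borel; have [] := bF x.
have mA : measurable (A : set (borel_group G)).
  by apply: open_borel; have [] := bA.
(* Only measurability of [A] is kept, because the induction removes [F x] from [A] and the
   difference need not be open. *)
elim: s A {bA} mA AF => [|x s IH] A mA AF.
  rewrite big_nil (_ : A = set0) ?measure0//.
  by rewrite -subset0 => y /AF[].
rewrite big_cons; apply: (@le_trans _ _ (mu (F x) + mu (A `\` F x)))%E.
  apply: (@le_trans _ _ (mu (F x `|` (A `\` F x)))).
    apply: le_measure; rewrite ?inE//.
      by apply: measurableU => //; exact: measurableD.
    by move=> y Ay; have [|] := pselect (F x y); [left|right].
  by apply: measureU2 => //; exact: measurableD.
rewrite leeD2l//; apply: IH; first exact: measurableD.
move=> y [/AF[z]]; rewrite inE => /predU1P[->//|zs Fz _]; by exists z.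
Qed.

Lemma content_packing (s : seq G) (F : G -> set G) A : uniq s ->
  bounded_open d A -> (forall x, bounded_open d (F x)) ->
  (forall x, x \in s -> F x `<=` A) ->
  (forall x y, x \in s -> y \in s -> F x `&` F y !=set0 -> x = y) ->
  \sum_(x <- s) content (F x) <= content A.
Proof.
move=> us bA bF; rewrite -lee_fin -contentE// -sumEFin.
under eq_bigr do rewrite -contentE//.
have mF x : measurable (F x : set (borel_group G)).
  by apply: open_borel; have [] := bF x.
have mA : measurable (A : set (borel_group G)).
  by apply: open_borel; have [] := bA.
elim: s A us {bA} mA => [|x s IH] A us mA FA Finj; first by rewrite big_nil.
move: us => /= /andP[xs us]; rewrite big_cons.
have -> : mu A = (mu (F x) + mu (A `\` F x))%E.
  rewrite -[X in mu X = _](@setDKU _ (F x)); last by apply: FA; rewrite mem_head.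
  rewrite setUC measureU//; first exact: measurableD.
  by rewrite setDE setICA setICr setI0.
rewrite leeD2l//; apply: IH => //; first exact: measurableD.
  move=> y ys z Fyz; split; first by apply: (FA y) => //; rewrite inE ys orbT.
  move=> Fxz; have xy : x = y.
    by apply: Finj; rewrite ?inE ?eqxx ?ys ?orbT//; exists z.
  by move: xs; rewrite xy ys.
by move=> y z ys zs; apply: Finj; rewrite inE ?ys ?zs orbT.
Qed.

(** By uniqueness of the Haar measure, any bounded open set of positive measure gives the same ratio
    as the unit ball. *)
Definition modular g : R :=
  content (rtranslate g (gball d 1)) / content (gball d 1).

(** Uniqueness is applied to [mu] and its right translate by [g], on [U] and the unit ball. *)
Lemma content_rtranslate g U : bounded_open d U ->
  content (rtranslate g U) = modular g * content U.
Proof.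
move=> bU; have [nu hnu nuE] := haar_rtranslate g hmu.
have b1 : bounded_open d (gball d 1) := gball_bounded_open md 1.
have := haar_ratio lcscG md hmu hnu bU b1.
rewrite !nuE !contentE//; try exact: rtranslate_bounded_open.
rewrite -!EFinM => -[h]; rewrite /modular.
rewrite mulrAC; apply: (canRL (mulfK _)) => //.
  by rewrite gt_eqF// content_gball_gt0.
by rewrite mulrC [RHS]mulrC h mulrC.
Qed.

Lemma modularM g h : modular (g * h)%g = modular g * modular h.
Proof.
have b1 : bounded_open d (gball d 1) := gball_bounded_open md 1.
rewrite {1}/modular (_ : rtranslate (g * h)%g _ =
  rtranslate h (rtranslate g (gball d 1))).
  rewrite content_rtranslate; last exact: rtranslate_bounded_open.
  by rewrite content_rtranslate// mulrA mulfK ?gt_eqF ?content_gball_gt0// mulrC.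
by rewrite !rtranslateE; apply/funext => x /=; rewrite invgM mulgA.
Qed.

Lemma modular1 : modular 1%g = 1.
Proof.
rewrite /modular (_ : rtranslate _ _ = gball d 1).
  by rewrite divff// gt_eqF// content_gball_gt0.
by rewrite rtranslateE; apply/funext => x /=; rewrite invg1 mulg1.
Qed.

Lemma modular_gt0 g : 0 < modular g.
Proof.
rewrite lt_neqAle divr_ge0 ?content_ge0// andbT eq_sym; apply/eqP => g0.
have := modular1; rewrite -(mulgV g) modularM g0 mul0r => /eqP.
by rewrite eq_sym oner_eq0.
Qed.

Lemma modularV g : modular g^-1%g = (modular g)^-1.
Proof.
by apply: (mulfI (lt0r_neq0 (modular_gt0 g)));
  rewrite -modularM mulgV modular1 divff// lt0r_neq0// modular_gt0.
Qed.

(** For [x] of length less than [r], the translate of the unit ball by [x] lies in the ball of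
    radius [1 + r]; this bounds [modular] above, and inversion gives the lower bound. *)
Lemma modular_gball_bound r :
  exists2 c, 0 < c & forall x, gball d r x -> c <= modular x.
Proof.
(* The [+ 1] makes [M] positive for every [r], so that it can be inverted. *)
pose M := content (gball d (1 + r)) / content (gball d 1) + 1.
have M0 : 0 < M by rewrite ltr_pwDr// divr_ge0 ?content_ge0.
have ub x : gball d r x -> modular x <= M.
  move=> xr; rewrite /M /modular ler_wpDr//.
  rewrite ler_pM2r ?invr_gt0 ?content_gball_gt0//.
  apply: le_content.
  - by apply: (rtranslate_bounded_open md); exact: gball_bounded_open.
  - exact: gball_bounded_open.
  - by move=> _ [y y1 <-]; exact: gballM.
exists M^-1; first by rewrite invr_gt0.
move=> x xr; rewrite invf_ple ?posrE ?modular_gt0//.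
by rewrite -modularV; apply: ub; exact: gballV.
Qed.

(** * Separated sets and boundedness of the modular function *)

Definition separated r (s : seq G) : Prop :=
  forall x y, x \in s -> y \in s -> d x y < r -> x = y.

(** The balls of radius [r] around separated points of [A] are disjoint and of equal measure inside
    [A] times a ball, which bounds their number. A separated family of maximal size cannot be
    enlarged, hence covers [A]. *)
Lemma maximal_separated A r : 0 < r -> bounded_open d A ->
  exists s : seq G, [/\ uniq s, forall x, x \in s -> A x,
    separated (r + r) s &
    forall y, A y -> exists2 x, x \in s & d x y < r + r].
Proof.
move=> r0 bA.
pose P n := `[< exists s : seq G, [/\ size s = n, uniq s,
  forall x, x \in s -> A x & separated (r + r) s] >].
have bAr : bounded_open d (set_mulg A (gball d r)).
  apply: set_mulg_bounded_open (gball_bounded_open md r); first exact: md.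
  by have [] := bA.
have m0 := content_gball_gt0 r0.
pose M := Num.truncn (content (set_mulg A (gball d r)) / content (gball d r)).
have PM n : P n -> (n <= M)%N.
  move=> /asboolP[s [<- us sA ss]]; rewrite truncn_ge_nat; last first.
    by rewrite divr_ge0 ?content_ge0.
  rewrite ler_pdivlMr//.
  have -> : (size s)%:R * content (gball d r) =
      \sum_(x <- s) content (ltranslate x (gball d r)).
    rewrite (eq_bigr (fun=> content (gball d r))) => [|x _].
      by rewrite big_const_seq count_predT iter_addr_0 mulr_natl.
    by rewrite content_ltranslate//; exact: gball_bounded_open.
  apply: content_packing => //.
  - by move=> x; apply: (ltranslate_bounded_open md); exact: gball_bounded_open.
  - by move=> x xs _ [y yr <-]; exists x; [exact: sA|exists y].
  - move=> x y xs ys; rewrite !(ltranslate_gball md) => -[z [/= xz yz]].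
    apply: ss => //; apply: le_lt_trans (plim_triangle md x z y) _.
    by rewrite ltrD// (plim_sym md).
have P0 : exists n, P n by exists 0%N; apply/asboolP; exists [::].
case: (ex_maxnP P0 PM) => n /asboolP[s [sn us sA ss]] nmax.
exists s; split=> // y Ay; apply: contrapT => sy.
have /nmax : P n.+1; last by rewrite ltnn.
have ys : y \notin s.
  by apply/negP => ys; apply: sy; exists y; rewrite ?(metricxx md)// addr_gt0.
apply/asboolP; exists (y :: s); split => /=; rewrite ?sn ?ys//.
  by move=> x; rewrite inE => /predU1P[->//|/sA].
move=> x z; rewrite !inE => /predU1P[->|xs] /predU1P[->|zs] //.
- by rewrite (plim_sym md) => zy; case: sy; exists z.
- by move=> xy; case: sy; exists x.
- exact: ss.
Qed.

(* Finitely many left translates of [B_1] cover [B_r], and by inversion so do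
   finitely many right translates. *)
Lemma content_double_coset r :
  exists2 C, 0 < C & forall g,
    content (set_mulg (gball d r) (ltranslate g (gball d r))) <=
    C * content (set_mulg (gball d 1) (ltranslate g (gball d 1))).
Proof.
have half0 : 0 < 2^-1 :> R by rewrite invr_gt0.
have [F [_ _ _ FP]] := maximal_separated half0 (gball_bounded_open md r).
have half2 : 2^-1 + 2^-1 = 1 :> R by lra.
rewrite half2 in FP.
(* The set is covered by the translates of [A] by [f] on the left, which cost nothing, and by the
   inverse of [f'] on the right, which cost a value of [modular]. *)
pose C := (\sum_(f <- F) \sum_(f' <- F) modular f'^-1%g).
have C0 : 0 <= C.
  by do 2!apply: sumr_ge0 => ? _; exact/ltW/modular_gt0.
exists (C + 1) => [|g]; first by rewrite ltr_pwDr.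
pose A := set_mulg (gball d 1) (ltranslate g (gball d 1)).
have bA : bounded_open d A.
  apply: (set_mulg_bounded_open md); first by exists 1.
  by apply: (ltranslate_bounded_open md); exact: gball_bounded_open.
pose F2 f := set_mulg (ltranslate f (gball d 1)) (ltranslate g (gball d r)).
have bF2 f : bounded_open d (F2 f).
  apply: (set_mulg_bounded_open md).
    by have [] := ltranslate_bounded_open md f (gball_bounded_open md 1).
  by apply: (ltranslate_bounded_open md); exact: gball_bounded_open.
apply: (@le_trans _ _ (C * content A)); last first.
  by rewrite ler_wpM2r ?content_ge0// lerDl.
apply: (@le_trans _ _ (\sum_(f <- F) content (F2 f))).
  apply: content_cover => //.
    apply: (set_mulg_bounded_open md); first by exists r.
    by apply: (ltranslate_bounded_open md); exact: gball_bounded_open.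
  move=> _ [x /FP[f fF fx] [y yr <-]]; exists f => //.
  by exists x; [rewrite (ltranslate_gball md)|exists y].
rewrite mulr_suml; apply: ler_sum => f _; rewrite mulr_suml.
apply: (@le_trans _ _
  (\sum_(f' <- F) content (ltranslate f (rtranslate f'^-1%g A)))).
  apply: content_cover => //.
    move=> f'; apply: (ltranslate_bounded_open md).
    exact: (rtranslate_bounded_open md).
  move=> _ [_ [u u1 <-] [_ [v vr <-] <-]].
  (* [f'] is close to the inverse of [v], so that [v f'] lies in the unit ball and [u g v] is
     [u g (v f')] times the inverse of [f']. *)
  have [f' f'F f'v] := FP _ (gballV md vr); exists f' => //.
  exists (u * (g * v))%g; last by rewrite mulgA.
  exists (u * (g * (v * f')))%g; last by rewrite !mulgA mulgK.
  exists u => //; exists (g * (v * f'))%g => //; exists (v * f')%g => //.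
  by move: f'v; rewrite (plim_sym md) (metricE md) invgK.
apply: ler_sum => f' _; rewrite content_ltranslate.
  by rewrite content_rtranslate.
exact: (rtranslate_bounded_open md).
Qed.

(** The counting argument for [A = B_1 g B_1]. The point [p] may depend on [hs], as it will come
    from an element of the hull chosen after [hs]. *)
Lemma modular_bounded (S : set G) (e b : R) : 0 < e -> 0 < b ->
  (forall x y, S x -> S y -> d 1%g (x * y^-1)%g < e -> x = y) ->
  (forall hs : seq G, exists2 p, gball d b p &
     (size hs <= (count
       (fun h => `[< exists2 x, S x & (d h (p * x)%g < b)%R >]) hs).*2)%N) ->
  exists C, forall g, modular g <= C.
Proof.
move=> e0 b0 Sdiscrete Sdense.
(* Each [x] found below is [u g v] with [u] and [v] in the ball of radius [b + 1]; the extra [e / 2]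
   makes room for the ball [U] placed to its left. *)
pose r := e / 2 + b + 1.
have [c c0 cP] := modular_gball_bound (b + 1).
have [C C0 CP] := content_double_coset r.
have e20 : 0 < e / 2 by rewrite divr_gt0.
have mU := content_gball_gt0 e20; set mu_U := content _ in mU.
pose M := content (gball d (b + b)).
have M0 : 0 <= M := content_ge0 _.
(* With [n] good points, [n c D(g) c mu_U <= C content A <= C (2 n M)]; then [n] cancels. *)
exists (C * 2 * M / (c * c * mu_U)) => g.
pose A := set_mulg (gball d 1) (ltranslate g (gball d 1)).
have bA : bounded_open d A.
  apply: (set_mulg_bounded_open md); first by exists 1.
  by apply: (ltranslate_bounded_open md); exact: gball_bounded_open.
have [hs [uhs hsA hsS hsP]] := maximal_separated b0 bA.
have Ale : content A <= (size hs)%:R * M.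
  rewrite /M mulr_natl -iter_addr_0 -count_predT -big_const_seq.
  rewrite (eq_bigr (fun x => content (ltranslate x (gball d (b + b))))).
    apply: content_cover => //.
      by move=> x; apply: (ltranslate_bounded_open md); exact: gball_bounded_open.
    by move=> y /hsP[x xs xy]; exists x; rewrite ?(ltranslate_gball md).
  by move=> x _; rewrite content_ltranslate//; exact: gball_bounded_open.
have [p pb half] := Sdense hs.
pose good h := `[< exists2 x, S x & d h (p * x)%g < b >].
(* The default [1] occurs only when [h] is not good, and such [h] are filtered out. *)
pose x_ h := xget 1%g [set x | S x /\ d h (p * x)%g < b].
have x_P h : good h -> S (x_ h) /\ d h (p * x_ h)%g < b.
  move=> /asboolP[x Sx hx].
  exact: (xgetI (P := [set x | S x /\ d h (p * x)%g < b]) 1%g (x := x)).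
pose xs := [seq x_ h | h <- hs & good h].
(* If [h] and [k] share the same point [x], both are within [b] of [p x], so separation makes them
   equal. *)
have uxs : uniq xs.
  rewrite map_inj_in_uniq ?filter_uniq// => h k.
  rewrite !mem_filter => /andP[/x_P[_ hx] hhs] /andP[/x_P[_ kx] khs] xhk.
  apply: hsS => //; apply: le_lt_trans (plim_triangle md h (p * x_ h)%g k) _.
  by rewrite ltrD// (plim_sym md) xhk.
have sxs : size xs = count good hs by rewrite size_map size_filter.
have xsP x : x \in xs -> S x /\ exists u v,
    [/\ gball d (b + 1) u, gball d (b + 1) v & x = (u * g * v)%g].
  move=> /mapP[h]; rewrite mem_filter => /andP[/x_P[Sx hx] /hsA Ah] ->.
  split=> //; have [u u1 [_ [v v1 <-] uvE]] := Ah.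
  exists (p^-1 * u)%g, (v * (h^-1 * (p * x_ h)))%g; split.
  - by apply: (gballM md) => //; exact: gballV.
  - rewrite addrC; apply: (gballM md) => //.
    by rewrite /gball /= -(metricE md).
  - rewrite [RHS](_ : _ = p^-1 * (u * (g * v) * (h^-1 * (p * x_ h))))%g.
      by rewrite uvE mulVKg mulKg.
    by rewrite !mulgA.
have packed :
    \sum_(x <- xs) content (rtranslate x (gball d (e / 2))) <= C * content A.
  apply: le_trans (CP g); apply: content_packing => //.
  - apply: (set_mulg_bounded_open md); first by exists r.
    by apply: (ltranslate_bounded_open md); exact: gball_bounded_open.
  - by move=> x; apply: (rtranslate_bounded_open md); exact: gball_bounded_open.
  - move=> _ /xsP[_ [u [v [ub vb ->]]]] _ [w we <-].
    exists (w * u)%g; first by rewrite /r -addrA; exact: (gballM md).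
    exists (g * v)%g; last by rewrite !mulgA.
    by exists v => //; apply: gballW vb; rewrite /r; lra.
  (* A common point [u x = v y] puts the right quotient of [x] by [y] in the ball of radius [e]. *)
  - move=> x y /xsP[Sx _] /xsP[Sy _] [_ [[u ue <-] [v ve vu]]].
    apply: Sdiscrete => //.
    have -> : (x * y^-1 = u^-1 * v)%g.
      by apply: (mulgI u); rewrite mulVKg mulgA -vu mulgK.
    by rewrite (splitr e); apply: (gballM md) => //; exact: gballV.
have lower : (size xs)%:R * (c * modular g * c * mu_U) <= C * content A.
  apply: le_trans packed; rewrite mulr_natl -iter_addr_0 -count_predT -big_const_seq.
  rewrite big_seq [leRHS]big_seq; apply: ler_sum => _ /xsP[_ [u [v [ub vb ->]]]].
  rewrite content_rtranslate; last exact: gball_bounded_open.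
  rewrite ler_wpM2r ?content_ge0// !modularM.
  have g0 := ltW (modular_gt0 g).
  apply: ler_pM (mulr_ge0 (ltW c0) g0) (ltW c0) _ (cP _ vb).
  exact: ler_wpM2r g0 _ _ (cP _ ub).
(* Cancelling the count requires a good point: [A] contains [g], so [hs] is non-empty, and at least
   half of it is good. *)
have n0 : (0 < count good hs)%N.
  have hs0 : (0 < size hs)%N.
    have [|x xhs _] := hsP (1 * (g * 1))%g.
      exists 1%g; first exact: gball1.
      by exists (g * 1)%g => //; exists 1%g => //; exact: gball1.
    by case: hs xhs {uhs hsA hsS hsP Ale half uxs sxs xs xsP packed lower}.
  by have := leq_trans hs0 half; rewrite double_gt0.
rewrite ler_pdivlMr ?mulr_gt0//.
have k0 : 0 < (count good hs)%:R :> R by rewrite ltr0n.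
rewrite -(ler_pM2l k0).
have half' : (size hs)%:R <= 2 * (count good hs)%:R :> R.
  by rewrite -natrM ler_nat mul2n.
have : C * content A <= C * (2 * (count good hs)%:R * M).
  by rewrite ler_pM2l//; apply: le_trans Ale _; rewrite ler_wpM2r.
rewrite sxs in lower; move=> h; have := le_trans lower h; lra.
Qed.

(** If [modular g] exceeded 1, Bernoulli's inequality would make its powers, which are values of
    [modular], unbounded. The inverse of [g] gives the other inequality. *)
Lemma bounded_modular_eq1 C : (forall g, modular g <= C) ->
  forall g, modular g = 1.
Proof.
move=> CP.
have le1 g : modular g <= 1.
  rewrite leNgt; apply/negP => g1.
  pose a := modular g - 1; have a0 : 0 < a by rewrite subr_gt0.
  have C0 : 0 <= C by apply: le_trans (CP 1%g); exact/ltW/modular_gt0.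
  have bern n : 1 + n%:R * a <= modular (g ^+ n)%g.
    elim: n => [|n IH]; first by rewrite mul0r addr0 expg0 modular1.
    rewrite expgS modularM.
    have n0 : 0 <= n%:R :> R by [].
    have : modular g * (1 + n%:R * a) <= modular g * modular (g ^+ n)%g.
      by rewrite ler_wpM2l// ltW// modular_gt0.
    apply: le_trans; rewrite (_ : modular g = 1 + a); last by rewrite /a; lra.
    rewrite -natr1; nra.
  pose n := (Num.truncn (C / a)).+1.
  have := le_trans (bern n) (CP _).
  have : C / a < n%:R by rewrite /n truncnS_gt.
  rewrite ltr_pdivrMr//; lra.
move=> g; apply/eqP; rewrite eq_le le1/=.
by have := le1 g^-1%g; rewrite modularV invf_le1// modular_gt0.
Qed.

End Modular.

(** * Hulls *)

(** The measure and its right translate agree on the pi-system of bounded open sets, and balls of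
    integer radius exhaust [G] with finite measure. *)
Lemma modular_eq1_unimodular (R : realType) (G : topologicalGroupType)
    (d : G -> G -> R) (mu : {measure set borel_group G -> \bar R}) :
  lcsc G -> proper_left_invariant_metric d -> left_haar_measure mu ->
  (forall g, modular d mu g = 1) ->
  forall (g : G) (B : set (borel_group G)),
    measurable B -> mu (rtranslate g B) = mu B.
Proof.
move=> lcscG md hmu mod1 g B mB.
have [nu hnu nuE] := haar_rtranslate g hmu; rewrite -nuE.
apply: (@measure_unique _ R (borel_group G) (bounded_open d)
  (fun n => gball d n%:R)) => //.
- rewrite eqEsubset; split; last first.
    apply: smallest_sub => [|U [oU _]]; last exact: open_borel.
    exact: sigma_algebra_measurable.
  apply: smallest_sub; first exact: smallest_sigma_algebra.
  move=> U oU; pose b n := U `&` gball d n%:R.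
  have -> : U = \bigcup_n b n.
    rewrite eqEsubset; split=> [x Ux|x [n _ []]//].
    exists (Num.truncn (d 1%g x)).+1 => //.
    by split; rewrite // /gball /= truncnS_gt.
  have [_ _ sU] := smallest_sigma_algebra [set: borel_group G] (bounded_open d).
  apply: sU => n; apply: sub_sigma_algebra; split; last by exists n%:R => x [].
  by apply: openI => //; exact: gball_open.
- move=> U V [oU [r Ur]] [oV _]; split; first exact: openI.
  by exists r => x [/Ur].
- by move=> n; exact: gball_bounded_open.
- rewrite eqEsubset; split=> // x _.
  by exists (Num.truncn (d 1%g x)).+1 => //; rewrite /gball /= truncnS_gt.
- move=> U bU; rewrite nuE (contentE lcscG md hmu bU).
  rewrite (contentE lcscG md hmu (rtranslate_bounded_open md g bU)).
  by rewrite (content_rtranslate lcscG md hmu)// mod1 mul1r.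
- by move=> n; exact: haar_gball_lty.
Qed.

(** The expected number of events that occur is at least half their number, so some outcome attains
    it. *)
Lemma half_probability d (T : measurableType d) (R : realType)
    (P : probability T R) (I : Type) (F : I -> set T) (s : seq I) :
  (forall i, measurable (F i)) -> (forall i, ((2^-1)%:E <= P (F i))%E) ->
  exists w, (size s <= (count (fun i => w \in F i) s).*2)%N.
Proof.
move=> mF PF; apply: contrapT => /forallNP now.
have lt w : ((count (fun i => w \in F i) s).*2 < size s)%N.
  by rewrite ltnNge; apply/negP/now.
(* Counts being integers, the strict inequality improves to the constant bound [(size s - 1) / 2],
   which stays strict after integration. *)
have : (\int[P]_w (\sum_(i <- s) (\1_(F i) w)%:E) <=
        \int[P]_w cst (((size s)%:R - 1) / 2)%:E w)%E.
  apply: ge0_le_integral => //=.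
  - by move=> w _; apply: sume_ge0 => i _; rewrite lee_fin.
  - apply: emeasurable_sum => i; exact/measurable_EFinP/measurable_indic.
  - move=> w _; rewrite sumEFin lee_fin.
    rewrite (eq_bigr (fun i => (w \in F i)%:R)) => [|i _]; last by rewrite indicE.
    rewrite -natr_sum (_ : (\sum_(i <- s) (w \in F i) =
        count (fun i => w \in F i) s)%N).
      rewrite ler_pdivlMr// lerBrDr -natrM natr1 ler_nat.
      by rewrite muln2; exact: lt.
    by rewrite -sum1_count [RHS]big_mkcond; apply: eq_bigr => i _; case: (w \in F i).
rewrite ge0_integral_sum//; last first.
  by move=> i; exact/measurable_EFinP/measurable_indic.
rewrite integral_cst//= [X in (_ * X)%E]probability_setT mule1.
under eq_bigr do rewrite integral_indic// setIT.
rewrite leNgt => /negP; apply.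
apply: (@lt_le_trans _ _ (\sum_(i <- s) (2^-1)%:E)%E); last first.
  by apply: lee_sum => i _; exact: PF.
rewrite sumEFin lte_fin big_const_seq count_predT iter_addr_0 -[ltRHS]mulr_natl.
by rewrite ltr_pM2r ?invr_gt0// ltrBlDr ltrDl.
Qed.

Section Hulls.
Context {R : realType} {G : topologicalGroupType} (d : G -> G -> R).
Hypothesis md : proper_left_invariant_metric d.
Implicit Types (L S F : set G) (f g x y z : G).

(** The distance from [1] to [f l] is that from the inverse of [f] to [l]. If this inverse is in
    [L], uniform discreteness applies; otherwise closedness does. *)
Lemma isolated_translate L f : closed L -> uniformly_discrete d L ->
  exists2 e, 0 < e & forall l, L l -> d 1%g (f * l)%g < e -> (f * l)%g = 1%g.
Proof.
move=> cL [r r0 Lr].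
have fE l : d 1%g (f * l)%g = d f^-1%g l by rewrite [RHS](metricE md) invgK.
have [Lf|Lf] := pselect (L f^-1%g).
  exists r => // l Ll; rewrite fE => fl.
  apply: contrapT => fl1; suff : r <= d f^-1%g l by rewrite leNgt fl.
  by apply: Lr => // fE'; apply: fl1; rewrite -fE' mulgV.
have [e e0 eL] := open_metric md (closed_openC cL) Lf.
by exists e => // l Ll; rewrite fE => /eL.
Qed.

Lemma isolated_translates L F : closed L -> uniformly_discrete d L ->
  finite_set F -> exists2 e, 0 < e &
    forall z, set_mulg F L z -> d 1%g z < e -> z = 1%g.
Proof.
move=> cL uL /finite_seqP[s ->]; elim: s => [|f s [e e0 IH]].
  by exists 1 => // z [x].
have [e' e'0 fP] := isolated_translate f cL uL.
exists (Num.min e e'); first by rewrite lt_min e0.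
move=> _ [x /= + [l Ll <-]]; rewrite inE lt_min => /predU1P[->|xs] /andP[h h'].
  exact: fP.
by apply: IH h => //; exists x => //; exists l.
Qed.

(** Iterating [L^2] in [F L] puts [L^4] inside [F^3 L], a finite union of translates of [L], in each
    of which [1] is isolated or absent. *)
Lemma approximate_subgroup_isolated L : approximate_subgroup L -> closed L ->
  uniformly_discrete d L -> exists2 e, 0 < e & forall x y,
    set_mulg L L x -> set_mulg L L y -> d 1%g (x * y)%g < e -> (x * y)%g = 1%g.
Proof.
move=> [_ _ [F [fF _ FL]]] cL uL.
have [e e0 eP] : exists2 e, 0 < e & forall z,
    set_mulg (set_mulg F (set_mulg F F)) L z -> d 1%g z < e -> z = 1%g.
  apply: isolated_translates => //; apply: finite_image2 => //.
  exact: finite_image2.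
exists e => // x y Lx [c Lc [c' Lc' <-]]; apply: eP.
have [f1 F1 [l1 L1 xE]] := FL _ Lx.
have [f2 F2 [l2 L2 l1c]] : [set (f * x)%g | f in F & x in L] (l1 * c)%g.
  by apply: FL; exists l1 => //; exists c.
have [f3 F3 [l3 L3 l2c]] : [set (f * x)%g | f in F & x in L] (l2 * c')%g.
  by apply: FL; exists l2 => //; exists c'.
exists (f1 * (f2 * f3))%g.
  by exists f1 => //; exists (f2 * f3)%g => //; exists f2 => //; exists f3.
exists l3 => //.
by rewrite -xE -[RHS]mulgA (mulgA l1) -l1c -(mulgA f2 l2) -l2c !mulgA.
Qed.

Lemma approximate_subgroupV L x : approximate_subgroup L -> L x -> L x^-1%g.
Proof. by move=> [LE _ _] Lx; rewrite LE; exists x. Qed.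

Lemma set_mulgLLV L x : approximate_subgroup L ->
  set_mulg L L x -> set_mulg L L x^-1%g.
Proof.
move=> aL [a La [b Lb <-]]; exists b^-1%g; first exact: approximate_subgroupV.
by exists a^-1%g; [exact: approximate_subgroupV|rewrite invgM].
Qed.

(** Left quotients of elements of [L^2] lie in [L^4], where [1] is isolated; so [L^2] is uniformly
    discrete. *)
Lemma approximate_subgroup_mulg_closed L : approximate_subgroup L -> closed L ->
  uniformly_discrete d L -> closed (set_mulg L L).
Proof.
move=> aL cL uL; apply: (uniformly_discrete_closed md).
have [e e0 eP] := approximate_subgroup_isolated aL cL uL.
exists e => // x y Lx Ly xy; rewrite leNgt; apply/negP => dxy; apply: xy.
have := eP x^-1%g y (set_mulgLLV aL Lx) Ly; rewrite -(metricE md) => /(_ dxy).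
by move=> h; apply: (mulgI x^-1%g); rewrite h mulVg.
Qed.

Lemma fell_hit_open (V : set G) : open V -> open (fell_hit V).
Proof.
move=> oV; rewrite openE => P PV; apply: fell_subbase_nbhs => //.
by right; exists V.
Qed.

(** Left quotients within a translate [g L] lie in [L^2]. As [L^2] is closed, this passes to limits:
    otherwise some [g L] would meet small neighbourhoods of both [x] and [y]. *)
Lemma hull_difference (L : closed_sets G) (P : closed_sets G) x y :
  approximate_subgroup L -> uniformly_discrete d L ->
  hull L P -> closed_carrier P x -> closed_carrier P y -> set_mulg L L (x^-1 * y)%g.
Proof.
move=> aL uL hP Px Py; apply: contrapT => nxy.
have oC : open (~` set_mulg L L).
  apply: closed_openC; apply: approximate_subgroup_mulg_closed => //.
  exact: closed_setsP.
pose f (uv : G * G) := (uv.1^-1 * uv.2)%g.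
have cf : {for (x, y), continuous f}.
  apply: (@continuous_comp _ _ _ (fun uv : G * G => (uv.1^-1%g, uv.2))
    (fun xy : G * G => (xy.1 * xy.2)%g)); last exact: mulg_continuous.
  apply: cvg_pair => /=; last exact: cvg_snd.
  by apply: (@cvg_comp _ _ _ fst (fun x : G => x^-1%g) _ (nbhs x));
    [exact: cvg_fst|exact: invg_continuous].
have [[A B] [/= xA yB] AB] := cf _ (open_nbhs_nbhs (conj oC nxy)).
have hit z C : closed_carrier P z -> nbhs z C -> nbhs P (fell_hit C^°).
  move=> Pz zC; apply: open_nbhs_nbhs; split.
    by apply: fell_hit_open; exact: open_interior.
  by exists z.
have [_ [[g _ <-] [[u [/= gu Au]] [v [/= gv Bv]]]]] :=
  hP _ (filterI (hit x A Px xA) (hit y B Py yB)).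
apply: (AB (u, v)); first by split; exact: interior_subset.
move: gu gv => [l Ll <-] [l' Ll' <-]; rewrite /f /= invgM -mulgA mulKg.
by exists l^-1%g; [exact: approximate_subgroupV|exists l'].
Qed.

End Hulls.

(** * Random elements of the hull *)

Section HullProbability.
Context {R : realType} {G : topologicalGroupType} (d : G -> G -> R).
Hypothesis md : proper_left_invariant_metric d.
Variable L : closed_sets G.

Definition hull_hit (V : set G) : set (borel_hull L) :=
  [set P | fell_hit V (\val P)].

Lemma hull_hit_measurable V : open V -> measurable (hull_hit V).
Proof.
move=> oV; apply: sub_sigma_algebra.
apply: (@open_comp _ _ (set_val : set_type (hull L) -> closed_sets G)).
  by move=> P _; exact: initial_continuous.
exact: fell_hit_open.
Qed.

Lemma translate_hull_hit g V :
  translate_hull g (hull_hit V) = hull_hit (ltranslate g V).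
Proof.
rewrite eqEsubset; split=> [_ [P [x [Px Vx]] <-]|P [y [Py [x Vx xy]]]].
  by exists (g * x)%g; split; exists x.
exists (act_hull g^-1%g P).
  by exists x; split => //; exists y => //; rewrite -xy mulKg.
by apply: val_inj => /=; rewrite -actM mulgV act1.
Qed.

Variable nu : probability (borel_hull L) R.
Hypothesis nu_inv : forall g (B : set (borel_hull L)),
  measurable B -> nu (translate_hull g B) = nu B.
Hypothesis nu_empty : nu (hull_empty L) = 0%E.

(** A random element is almost surely non-empty, so it meets a large ball around [1] with
    probability near 1; invariance moves the centre. The value [3 / 4] lets two such events occur
    together with probability at least one half. *)
Lemma hull_hit_likely : exists2 b, 0 < b &
  forall g, ((3 / 4)%:E <= nu (hull_hit [set y | (d g y < b)%R]))%E.
Proof.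
pose E n := hull_hit (gball d n%:R).
have mE n : measurable (E n) by apply: hull_hit_measurable; exact: gball_open.
have UE : \bigcup_n E n = ~` hull_empty L.
  rewrite eqEsubset; split=> P /=.
    by move=> [n _ [x [Px _]]] P0; rewrite P0 in Px.
  move=> /eqP/set0P[x Px]; exists (Num.truncn (d 1%g x)).+1 => //.
  by exists x; split => //; rewrite /gball /= truncnS_gt.
have nuE : nu (E n) @[n --> \oo] --> 1%E.
  have <- : nu (\bigcup_n E n) = 1%E.
    rewrite UE probability_setC ?nu_empty ?sube0//.
    by rewrite -[hull_empty L]setCK -UE; apply/measurableC/bigcupT_measurable.
  apply: nondecreasing_cvg_mu => //; first exact: bigcupT_measurable.
  move=> n k nk; apply/subsetPset => P [x [Px xn]]; exists x; split => //.
  by apply: gballW xn; rewrite ler_nat.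
(* The successor makes the radius positive. *)
have [n En] : exists n, ((3 / 4)%:E <= nu (E n.+1))%E.
  apply: contrapT => /forallNP h.
  have : (1 <= (3 / 4 : R)%:E)%E.
    apply: (@cvge_to_le _ \oo _ _ (fun n => nu (E n.+1)) _ _ _).
      by move: nuE; rewrite -cvg_shiftS.
    by near=> n; rewrite leNgt; apply/negP => /ltW/h.
  by rewrite lee_fin; lra.
exists n.+1%:R => // g; rewrite -(ltranslate_gball md) -translate_hull_hit.
by rewrite nu_inv//; exact: mE.
Unshelve. all: by end_near. Qed.

Lemma hull_hit_often : exists2 b, 0 < b & forall hs : seq G,
  exists P : set_type (hull L), hull_hit (gball d b) P /\
    (size hs <= (count (fun h => P \in hull_hit [set y | (d h y < b)%R]) hs).*2)%N.
Proof.
have [b b0 bP] := hull_hit_likely; exists b => // hs.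
pose hit g := hull_hit [set y | d g y < b].
have mhit g : measurable (hit g).
  by apply: hull_hit_measurable; exact: metric_ball_open.
have hit_half g : ((2^-1)%:E <= nu (hit 1%g `&` hit g))%E.
  have := bP 1%g; have := bP g; rewrite -/(hit g) -/(hit 1%g).
  have fin A : measurable A -> nu A \is a fin_num by exact: fin_num_measure.
  have mI := measurableI _ _ (mhit 1%g) (mhit g).
  have : (nu (~` (hit 1%g `&` hit g)) <= nu (~` hit 1%g) + nu (~` hit g))%E.
    by rewrite setCI; apply: measureU2; exact: measurableC.
  rewrite !probability_setC//.
  rewrite -(fineK (fin _ mI)) -(fineK (fin _ (mhit 1%g))) -(fineK (fin _ (mhit g))).
  by rewrite -!EFinB -EFinD !lee_fin; lra.
(* For non-empty [hs] some event occurs at [P], whence [P] meets the ball around [1]. The empty list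
   is served by the [P] found for the list of [1] alone. *)
wlog hs0 : hs / (0 < size hs)%N.
  case: hs => [h|h hs]; last by apply.
  by have [P [P1 _]] := h [:: 1%g] isT; exists P.
have [P hsP] := half_probability hs
  (fun g => measurableI _ _ (mhit 1%g) (mhit g)) hit_half.
exists P; split.
  have : (0 < count (fun g => P \in hit 1%g `&` hit g) hs)%N.
    by rewrite -double_gt0; exact: leq_trans hs0 hsP.
  by rewrite -has_count => /hasP[g _ /set_mem[]].
apply: leq_trans hsP _; rewrite leq_double; apply: sub_count => g /set_mem[_ ?].
exact: mem_set.
Qed.

End HullProbability.

(** * The two kinds of approximate lattice *)

Theorem theorem1p11 (R : realType) (G : topologicalGroupType)
    (d : G -> G -> R) (lcscG : lcsc G)
    (metric_d : proper_left_invariant_metric d) :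
  (exists L : set G, strong_approximate_lattice d L) \/
  (exists L : set G,
      approx_finitely_generated L /\ uniform_approximate_lattice d L) ->
  unimodular R G.
Proof.
move=> lattice mu hmu.
apply: (modular_eq1_unimodular lcscG metric_d hmu).
suff [C CP] : exists C, forall g, modular d mu g <= C.
  exact: (bounded_modular_eq1 lcscG metric_d hmu CP).
case: lattice => [[L [aL uL [cL [nu [nu_inv nu_empty]]]]]|].
  have [e e0 eP] := approximate_subgroup_isolated metric_d aL cL uL.
  have [b b0 bP] := hull_hit_often metric_d nu_inv nu_empty.
  (* A random [P] of the hull need not be a translate of [L], but it is contained in [p L^2] for any
     of its points [p]; hence [S = L^2]. *)
  apply: (modular_bounded lcscG metric_d hmu (S := set_mulg L L) e0 b0).
    move=> x y Lx Ly /(eP _ _ Lx (set_mulgLLV aL Ly)) xy.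
    by apply: (mulIg y^-1%g); rewrite xy mulgV.
  move=> hs; have [P [[p [Pp pb]] half]] := bP hs; exists p => //.
  apply: leq_trans half _; rewrite leq_double; apply: sub_count => h.
  move=> /set_mem[y [Py hy]]; apply/asboolP; exists (p^-1 * y)%g.
    exact: (hull_difference metric_d (L := ClosedSet cL) aL uL (set_valP P) Pp Py).
  by rewrite mulVKg.
move=> [L [_ [aL [_ [e e0 eP] [b b0 bP]]]]].
apply: (modular_bounded lcscG metric_d hmu (S := L) e0 b0).
  (* The condition concerns right quotients while [d] is left-invariant, so discreteness is applied
     to the inverses, which lie in [L] by symmetry. *)
  move=> x y Lx Ly xy; apply: invg_inj; apply: contrapT => nxy.
  have := eP _ _ (approximate_subgroupV aL Lx) (approximate_subgroupV aL Ly) nxy.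
  by rewrite leNgt (metricE metric_d) invgK xy.
(* By relative density every ball of radius [b] meets [L] itself, so all of [hs] is counted with
   [p = 1]. *)
move=> hs; exists 1%g; first exact: gball1.
rewrite (eq_count (a2 := xpredT)) => [|h].
  by rewrite count_predT -addnn leq_addr.
by apply/asboolP; have [x Lx hx] := bP h; exists x; rewrite ?mul1g.
Qed.
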